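(* Let $\lambda\neq0$. The general solution $\perp$ to the 4-term relations on the exterior algebra $\Omega$ of the $\beta=1$ calculus on the bicrossproduct spacetime $A$ has the form $$\mathrm{Vol}\perp e_i=-e_i\perp\mathrm{Vol}=b\,e_i,\quad e_1\perp e_1=0,\quad e_1\perp e_2=b,\quad e_2\perp e_1=-b,\quad e_2\perp e_2=-\lambda b,$$ $$\mathrm{Vol}\perp\mathrm{Vol}=2b\,\mathrm{Vol}$$ ($i=1,2$) for some constant parameter $b\in\mathbb{C}$.
   Context: Fix an imaginary $\lambda\in\mathbb{C}$. $A$ is the unital $\mathbb{C}$-algebra generated by $r,r^{-1},t$ with $rr^{-1}=r^{-1}r=1$ and $[r,t]=\lambda r$. The $\beta=1$ calculus is $[r,\mathrm{d}t]=\lambda\mathrm{d}r$, $[t,\mathrm{d}t]=\lambda\mathrm{d}t$, $[r,\mathrm{d}r]=0$, $[t,\mathrm{d}r]=0$. The 1-forms $e_1=\mathrm{d}r$, $e_2=r\,\mathrm{d}t-t\,\mathrm{d}r$ commute with $A$ and are a free left $A$-basis of $\Omega^1$. The exterior algebra is $\Omega=A\oplus\Omega^1\oplus\Omega^2$ with $e_1^2=0$, $e_2^2=-\lambda\mathrm{Vol}$, $e_1e_2+e_2e_1=0$, where $\mathrm{Vol}=e_1e_2$ is a central free basis of $\Omega^2$. A solution of the 4-term relations is a degree $-2$ bilinear map $\perp$ (so $\Omega^m\perp\Omega^n\subseteq\Omega^{m+n-2}$) that is an $A$-bimodule map $\Omega\otimes_A\Omega\to\Omega$, satisfies $a\perp\omega=\omega\perp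 a=0$ for $a\in A$, and for all homogeneous $\omega,\eta,\zeta\in\Omega$ $$(-1)^{|\eta|}(\omega\eta)\perp\zeta+(\omega\perp\eta)\zeta=\omega\perp(\eta\zeta)+(-1)^{|\omega|+|\eta|}\omega(\eta\perp\zeta).$$ ''General solution'' means that every solution has this form for some $b$, and every $b\in\mathbb{C}$ gives a solution. *)

(* Defs.v *)
From HB Require Import structures.
From mathcomp Require Import all_boot all_order all_algebra.
From mathcomp Require Import boolp.

Set Implicit Arguments.
Unset Strict Implicit.
Unset Printing Implicit Defensive.

Import Order.TTheory GRing.Theory Num.Theory.
Local Open Scope ring_scope.
Local Open Scope quotient_scope.

(* The bicrossproduct algebra is built from its presentation: formal
   expressions in r, r^-1, t and scalars, modulo the smallest congruence
   containing the laws of unital algebras over F and the three relations. *)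

Inductive bicross_expr (F : Type) : Type :=
  | EGenR
  | EGenRi
  | EGenT
  | EConst of F
  | EAdd of bicross_expr F & bicross_expr F
  | EMul of bicross_expr F & bicross_expr F.

Arguments EGenR {F}.
Arguments EGenRi {F}.
Arguments EGenT {F}.

HB.instance Definition _ (F : Type) := gen_eqMixin (bicross_expr F).
HB.instance Definition _ (F : Type) := gen_choiceMixin (bicross_expr F).

Section Algebra.
Variables (F : fieldType) (lam : F).

Local Notation expr := (bicross_expr F).

Inductive bicross_cong : expr -> expr -> Prop :=
  | cong_refl x : bicross_cong x x
  | cong_sym x y : bicross_cong x y -> bicross_cong y x
  | cong_trans x y z : bicross_cong x y -> bicross_cong y z -> bicross_cong x z
  | cong_add x x' y y' : bicross_cong x x' -> bicross_cong y y' ->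
      bicross_cong (EAdd x y) (EAdd x' y')
  | cong_mul x x' y y' : bicross_cong x x' -> bicross_cong y y' ->
      bicross_cong (EMul x y) (EMul x' y')
  | cong_addA x y z : bicross_cong (EAdd x (EAdd y z)) (EAdd (EAdd x y) z)
  | cong_addC x y : bicross_cong (EAdd x y) (EAdd y x)
  | cong_add0 x : bicross_cong (EAdd (EConst 0) x) x
  | cong_addN x : bicross_cong (EAdd (EMul (EConst (-1)) x) x) (EConst 0)
  | cong_mulA x y z : bicross_cong (EMul x (EMul y z)) (EMul (EMul x y) z)
  | cong_mul1l x : bicross_cong (EMul (EConst 1) x) x
  | cong_mul1r x : bicross_cong (EMul x (EConst 1)) x
  | cong_mulDl x y z :
      bicross_cong (EMul (EAdd x y) z) (EAdd (EMul x z) (EMul y z))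
  | cong_mulDr x y z :
      bicross_cong (EMul x (EAdd y z)) (EAdd (EMul x y) (EMul x z))
  | cong_constD a b : bicross_cong (EConst (a + b)) (EAdd (EConst a) (EConst b))
  | cong_constM a b : bicross_cong (EConst (a * b)) (EMul (EConst a) (EConst b))
  | cong_constC a x : bicross_cong (EMul (EConst a) x) (EMul x (EConst a))
  | cong_rri : bicross_cong (EMul EGenR EGenRi) (EConst 1)
  | cong_rir : bicross_cong (EMul EGenRi EGenR) (EConst 1)
  | cong_rt : bicross_cong (EMul EGenR EGenT)
      (EAdd (EMul EGenT EGenR) (EMul (EConst lam) EGenR)).

Definition bicross_rel : rel expr := fun x y => `[< bicross_cong x y >].

Lemma bicross_rel_refl : reflexive bicross_rel.
Proof. by move=> x; apply/asboolP; apply: cong_refl. Qed.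

Lemma bicross_rel_sym : symmetric bicross_rel.
Proof. by move=> x y; apply/asboolP/asboolP; apply: cong_sym. Qed.

Lemma bicross_rel_trans : transitive bicross_rel.
Proof.
move=> y x z /asboolP xy /asboolP yz; apply/asboolP.
exact: cong_trans xy yz.
Qed.

Canonical bicross_equiv :=
  EquivRel bicross_rel bicross_rel_refl bicross_rel_sym bicross_rel_trans.

Definition bicross : Type := {eq_quot bicross_rel}.

HB.instance Definition _ := Choice.on bicross.
HB.instance Definition _ := EqQuotient.on bicross.

Definition bicross_class (x : expr) : bicross := \pi_bicross x.

Lemma bicross_classP x y :
  bicross_class x = bicross_class y <-> bicross_cong x y.
Proof.
split; first by move/eqmodP => /asboolP.
by move=> xy; apply/eqmodP/asboolP.
Qed.

Lemma bicross_classK a : bicross_class (repr a) = a.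
Proof. exact: reprK. Qed.

Lemma repr_bicross_class x : bicross_cong (repr (bicross_class x)) x.
Proof. by apply/bicross_classP; rewrite bicross_classK. Qed.

Definition bicross_const (c : F) := bicross_class (EConst c).

(* Locked, so that unification does not see through the operations. *)
Definition bicross_add : bicross -> bicross -> bicross :=
  locked (fun a b => bicross_class (EAdd (repr a) (repr b))).
Definition bicross_mul : bicross -> bicross -> bicross :=
  locked (fun a b => bicross_class (EMul (repr a) (repr b))).
Definition bicross_opp : bicross -> bicross :=
  locked (bicross_mul (bicross_const (-1))).
Definition bicross_scale : F -> bicross -> bicross :=
  locked (fun c => bicross_mul (bicross_const c)).

Lemma bicross_addE x y :
  bicross_add (bicross_class x) (bicross_class y) = bicross_class (EAdd x y).
Proof.
rewrite /bicross_add -lock.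
by apply/bicross_classP/cong_add; apply: repr_bicross_class.
Qed.

Lemma bicross_mulE x y :
  bicross_mul (bicross_class x) (bicross_class y) = bicross_class (EMul x y).
Proof.
rewrite /bicross_mul -lock.
by apply/bicross_classP/cong_mul; apply: repr_bicross_class.
Qed.

Lemma bicross_oppE a : bicross_opp a = bicross_mul (bicross_const (-1)) a.
Proof. by rewrite /bicross_opp -lock. Qed.

Lemma bicross_scaleE c a : bicross_scale c a = bicross_mul (bicross_const c) a.
Proof. by rewrite /bicross_scale -lock. Qed.

Lemma bicross_ind (P : bicross -> Prop) :
  (forall x, P (bicross_class x)) -> forall a, P a.
Proof. by move=> Px a; rewrite -(bicross_classK a). Qed.

Lemma bicross_addA : associative bicross_add.
Proof.
elim/bicross_ind=> x; elim/bicross_ind=> y; elim/bicross_ind=> z.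
by rewrite !bicross_addE; apply/bicross_classP/cong_addA.
Qed.

Lemma bicross_addC : commutative bicross_add.
Proof.
elim/bicross_ind=> x; elim/bicross_ind=> y.
by rewrite !bicross_addE; apply/bicross_classP/cong_addC.
Qed.

Lemma bicross_add0 : left_id (bicross_const 0) bicross_add.
Proof.
by elim/bicross_ind=> x; rewrite bicross_addE; apply/bicross_classP/cong_add0.
Qed.

Lemma bicross_addN : left_inverse (bicross_const 0) bicross_opp bicross_add.
Proof.
elim/bicross_ind=> x; rewrite bicross_oppE bicross_mulE bicross_addE.
exact/bicross_classP/cong_addN.
Qed.

HB.instance Definition _ := GRing.isZmodule.Build bicross
  bicross_addA bicross_addC bicross_add0 bicross_addN.

Lemma bicross_mulA : associative bicross_mul.
Proof.
elim/bicross_ind=> x; elim/bicross_ind=> y; elim/bicross_ind=> z.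
by rewrite !bicross_mulE; apply/bicross_classP/cong_mulA.
Qed.

Lemma bicross_mul1l : left_id (bicross_const 1) bicross_mul.
Proof.
by elim/bicross_ind=> x; rewrite bicross_mulE; apply/bicross_classP/cong_mul1l.
Qed.

Lemma bicross_mul1r : right_id (bicross_const 1) bicross_mul.
Proof.
by elim/bicross_ind=> x; rewrite bicross_mulE; apply/bicross_classP/cong_mul1r.
Qed.

Lemma bicross_mulDl : left_distributive bicross_mul +%R.
Proof.
elim/bicross_ind=> x; elim/bicross_ind=> y; elim/bicross_ind=> z.
rewrite /GRing.add /= !(bicross_addE, bicross_mulE).
exact/bicross_classP/cong_mulDl.
Qed.

Lemma bicross_mulDr : right_distributive bicross_mul +%R.
Proof.
elim/bicross_ind=> x; elim/bicross_ind=> y; elim/bicross_ind=> z.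
rewrite /GRing.add /= !(bicross_addE, bicross_mulE).
exact/bicross_classP/cong_mulDr.
Qed.

(* Non-triviality: r acts on functions int -> F as the shift, and t as
   multiplication by n |-> n lam. *)
Fixpoint bicross_shift (x : expr) (f : int -> F) : int -> F :=
  match x with
  | EGenR => fun n => f (n + 1)
  | EGenRi => fun n => f (n - 1)
  | EGenT => fun n => lam *~ n * f n
  | EConst c => fun n => c * f n
  | EAdd y z => fun n => bicross_shift y f n + bicross_shift z f n
  | EMul y z => bicross_shift y (bicross_shift z f)
  end.

Lemma bicross_shift_linear x (a : F) f g :
  bicross_shift x (fun n => a * f n + g n) =
  fun n => a * bicross_shift x f n + bicross_shift x g n.
Proof.
elim: x f g => [||| c | y IHy z IHz | y IHy z IHz] f g /=.
- by apply/funext=> n.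
- by apply/funext=> n.
- by apply/funext=> n; rewrite mulrDr mulrCA.
- by apply/funext=> n; rewrite mulrDr mulrCA.
- by apply/funext=> n; rewrite IHy IHz mulrDr addrACA.
- by rewrite IHz IHy.
Qed.

Lemma bicross_shiftD x f g :
  bicross_shift x (fun n => f n + g n) =
  fun n => bicross_shift x f n + bicross_shift x g n.
Proof.
have := bicross_shift_linear x 1 f g.
under eq_fun do rewrite mul1r.
by move=> ->; apply/funext=> n; rewrite mul1r.
Qed.

Lemma bicross_shiftZ x (a : F) f :
  bicross_shift x (fun n => a * f n) = fun n => a * bicross_shift x f n.
Proof.
have E0 : bicross_shift x (fun=> 0) = fun=> 0.
  have := bicross_shift_linear x (-1) (fun=> 0) (fun=> 0).
  under eq_fun do rewrite mulr0 add0r.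
  by move=> ->; apply/funext=> n; rewrite mulN1r addNr.
have := bicross_shift_linear x a f (fun=> 0).
under eq_fun do rewrite addr0.
by move=> ->; apply/funext=> n; rewrite E0 addr0.
Qed.

Lemma bicross_shift_cong x y :
  bicross_cong x y -> bicross_shift x = bicross_shift y.
Proof.
elim=> {x y} //=.
- by move=> x y z _ -> _ ->.
- by move=> x x' y y' _ -> _ ->.
- by move=> x x' y y' _ -> _ ->.
- by move=> x y z; do 2![apply/funext=> ?]; rewrite addrA.
- by move=> x y; do 2![apply/funext=> ?]; rewrite addrC.
- by move=> x; do 2![apply/funext=> ?]; rewrite mul0r add0r.
- by move=> x; do 2![apply/funext=> ?]; rewrite mulN1r mul0r addNr.
- by move=> x; do 2![apply/funext=> ?]; rewrite mul1r.
- by move=> x; apply/funext=> f; under eq_fun do rewrite mul1r.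
- by move=> x y z; apply/funext=> f; rewrite bicross_shiftD.
- by move=> a b; do 2![apply/funext=> ?]; rewrite mulrDl.
- by move=> a b; do 2![apply/funext=> ?]; rewrite mulrA.
- by move=> a x; apply/funext=> f; rewrite bicross_shiftZ.
- by do 2![apply/funext=> ?]; rewrite addrK mul1r.
- by do 2![apply/funext=> ?]; rewrite subrK mul1r.
- by do 2![apply/funext=> ?]; rewrite mulrzDr mulrDl.
Qed.

Lemma bicross_1neq0 : bicross_const 1 != 0.
Proof.
apply/eqP => /bicross_classP /bicross_shift_cong /(congr1 (fun f => f (fun=> 1) 0)).
by move/eqP; rewrite /= mul1r mul0r oner_eq0.
Qed.

HB.instance Definition _ := GRing.Zmodule_isNzRing.Build bicross
  bicross_mulA bicross_mul1l bicross_mul1r bicross_mulDl bicross_mulDr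
  bicross_1neq0.

Lemma bicross_constM c e : bicross_const (c * e) = bicross_const c * bicross_const e.
Proof. by rewrite /GRing.mul /= bicross_mulE; apply/bicross_classP/cong_constM. Qed.

Lemma bicross_constD c e : bicross_const (c + e) = bicross_const c + bicross_const e.
Proof. by rewrite /GRing.add /= bicross_addE; apply/bicross_classP/cong_constD. Qed.

Lemma bicross_constC c a : bicross_const c * a = a * bicross_const c.
Proof.
elim/bicross_ind: a => x; rewrite /GRing.mul /= !bicross_mulE.
exact/bicross_classP/cong_constC.
Qed.

Lemma bicross_scaleM c a : bicross_scale c a = bicross_const c * a.
Proof. exact: bicross_scaleE. Qed.

Lemma bicross_scaleA c e a :
  bicross_scale c (bicross_scale e a) = bicross_scale (c * e) a.
Proof. by rewrite !bicross_scaleM bicross_constM mulrA. Qed.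

Lemma bicross_scale1 : left_id 1 bicross_scale.
Proof. by move=> a; rewrite bicross_scaleM mul1r. Qed.

Lemma bicross_scaleDr : right_distributive bicross_scale +%R.
Proof. by move=> c a b; rewrite !bicross_scaleM mulrDr. Qed.

Lemma bicross_scaleDl a : {morph bicross_scale^~ a : c e / c + e}.
Proof. by move=> c e; rewrite !bicross_scaleM bicross_constD mulrDl. Qed.

HB.instance Definition _ := GRing.Zmodule_isLmodule.Build F bicross
  bicross_scaleA bicross_scale1 bicross_scaleDr bicross_scaleDl.

Lemma bicross_scaleAl c (a b : bicross) : c *: (a * b) = (c *: a) * b.
Proof. by rewrite /GRing.scale /= !bicross_scaleM mulrA. Qed.

HB.instance Definition _ := GRing.Lmodule_isLalgebra.Build F bicross
  bicross_scaleAl.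

Lemma bicross_scaleAr c (a b : bicross) : c *: (a * b) = a * (c *: b).
Proof.
by rewrite /GRing.scale /= !bicross_scaleM mulrA bicross_constC mulrA.
Qed.

HB.instance Definition _ := GRing.Lalgebra_isAlgebra.Build F bicross
  bicross_scaleAr.

Definition gen_r : bicross := bicross_class EGenR.
Definition gen_ri : bicross := bicross_class EGenRi.
Definition gen_t : bicross := bicross_class EGenT.

Lemma bicross_constE c : bicross_class (EConst c) = c%:A.
Proof. by rewrite /GRing.scale /= !bicross_scaleM mulr1. Qed.

Lemma bicross_classD x y :
  bicross_class (EAdd x y) = bicross_class x + bicross_class y.
Proof. by rewrite -bicross_addE. Qed.

Lemma bicross_classM x y :
  bicross_class (EMul x y) = bicross_class x * bicross_class y.
Proof. by rewrite -bicross_mulE. Qed.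

Lemma mul_r_ri : gen_r * gen_ri = 1.
Proof. by rewrite -bicross_classM; apply/bicross_classP/cong_rri. Qed.

Lemma mul_ri_r : gen_ri * gen_r = 1.
Proof. by rewrite -bicross_classM; apply/bicross_classP/cong_rir. Qed.

Lemma comm_r_t : gen_r * gen_t - gen_t * gen_r = lam *: gen_r.
Proof.
apply/eqP; rewrite subr_eq addrC; apply/eqP.
rewrite /GRing.scale /= !bicross_scaleM -!bicross_classM -bicross_classD.
exact/bicross_classP/cong_rt.
Qed.

(* Evaluation of expressions in a target algebra, and the universal property
   of the presentation. *)
Fixpoint bicross_eval (B : algType F) (r ri t : B) (x : expr) : B :=
  match x with
  | EGenR => r
  | EGenRi => ri
  | EGenT => t
  | EConst c => c%:A
  | EAdd y z => bicross_eval r ri t y + bicross_eval r ri t z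
  | EMul y z => bicross_eval r ri t y * bicross_eval r ri t z
  end.

Lemma bicross_eval_cong (B : algType F) (r ri t : B) :
  r * ri = 1 -> ri * r = 1 -> r * t - t * r = lam *: r ->
  forall x y, bicross_cong x y -> bicross_eval r ri t x = bicross_eval r ri t y.
Proof.
move=> rri rir rt x y; elim=> {x y} //=.
- by move=> x y z _ -> _ ->.
- by move=> x x' y y' _ -> _ ->.
- by move=> x x' y y' _ -> _ ->.
- by move=> x y z; rewrite addrA.
- by move=> x y; rewrite addrC.
- by move=> x; rewrite scale0r add0r.
- by move=> x; rewrite mulr_algl scaleN1r scale0r addNr.
- by move=> x y z; rewrite mulrA.
- by move=> x; rewrite mulr_algl scale1r.
- by move=> x; rewrite mulr_algr scale1r.
- by move=> x y z; rewrite mulrDl.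
- by move=> x y z; rewrite mulrDr.
- by move=> a b; rewrite scalerDl.
- by move=> a b; rewrite mulr_algl scalerA.
- by move=> a x; rewrite mulr_algl mulr_algr.
- by rewrite scale1r.
- by rewrite scale1r.
- by rewrite mulr_algl -rt addrC subrK.
Qed.

Lemma bicross_universal (B : algType F) (r ri t : B) :
  r * ri = 1 -> ri * r = 1 -> r * t - t * r = lam *: r ->
  exists! phi : bicross -> B,
    [/\ {morph phi : a b / a + b}, {morph phi : a b / a * b},
        forall c : F, phi c%:A = c%:A &
        [/\ phi gen_r = r, phi gen_ri = ri & phi gen_t = t]].
Proof.
move=> rri rir rt.
have E x : bicross_eval r ri t (repr (bicross_class x)) = bicross_eval r ri t x.
  exact/bicross_eval_cong/repr_bicross_class.
exists (fun a => bicross_eval r ri t (repr a)); split.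
  split.
  - by elim/bicross_ind=> x; elim/bicross_ind=> y; rewrite -bicross_classD !E.
  - by elim/bicross_ind=> x; elim/bicross_ind=> y; rewrite -bicross_classM !E.
  - by move=> c; rewrite -bicross_constE E.
  - by rewrite !E.
move=> psi [psiD psiM psiC [psir psiri psit]]; apply/funext=> a.
elim/bicross_ind: a => x; rewrite E.
elim: x => [||| c | y IHy z IHz | y IHy z IHz] //=.
- by rewrite bicross_constE psiC.
- by rewrite bicross_classD psiD -IHy -IHz.
- by rewrite bicross_classM psiM -IHy -IHz.
Qed.

End Algebra.

(* The exterior algebra: Form a0 a1 a2 a3 is a0 + a1 e1 + a2 e2 + a3 Vol, for
   a basis of central elements 1, e1, e2, Vol over the algebra A, with
   e1 e1 = 0, e1 e2 = - e2 e1 = Vol and e2 e2 = - lam Vol. *)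

Record forms (F : fieldType) (lam : F) : Type := Form {
  coef0 : bicross lam;
  coef1 : bicross lam;
  coef2 : bicross lam;
  coefV : bicross lam }.

HB.instance Definition _ (F : fieldType) (lam : F) := gen_eqMixin (forms lam).
HB.instance Definition _ (F : fieldType) (lam : F) :=
  gen_choiceMixin (forms lam).

Section Forms.
Variables (F : fieldType) (lam : F).

Local Notation A := (bicross lam).
Local Notation Om := (forms lam).

Definition form_zero : Om := Form 0 0 0 0.
Definition form_opp (x : Om) : Om :=
  let: Form a0 a1 a2 a3 := x in Form (- a0) (- a1) (- a2) (- a3).
Definition form_add (x y : Om) : Om :=
  let: Form a0 a1 a2 a3 := x in let: Form b0 b1 b2 b3 := y in
  Form (a0 + b0) (a1 + b1) (a2 + b2) (a3 + b3).
Definition form_scale (c : F) (x : Om) : Om :=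
  let: Form a0 a1 a2 a3 := x in Form (c *: a0) (c *: a1) (c *: a2) (c *: a3).
Definition form_one : Om := Form 1 0 0 0.
Definition form_mul (x y : Om) : Om :=
  let: Form a0 a1 a2 a3 := x in let: Form b0 b1 b2 b3 := y in
  Form (a0 * b0) (a0 * b1 + a1 * b0) (a0 * b2 + a2 * b0)
    (a0 * b3 + a3 * b0 + a1 * b2 - a2 * b1 - lam *: (a2 * b2)).

Lemma form_addA : associative form_add.
Proof. by case=> ? ? ? ? [] ? ? ? ? [] ? ? ? ?; rewrite /= !addrA. Qed.

Lemma form_addC : commutative form_add.
Proof. by case=> ? ? ? ? [] ? ? ? ?; congr Form; rewrite addrC. Qed.

Lemma form_add0 : left_id form_zero form_add.
Proof. by case=> ? ? ? ?; rewrite /= !add0r. Qed.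

Lemma form_addN : left_inverse form_zero form_opp form_add.
Proof. by case=> ? ? ? ?; rewrite /= !addNr. Qed.

HB.instance Definition _ := GRing.isZmodule.Build Om
  form_addA form_addC form_add0 form_addN.

Lemma form_scaleA c e x : form_scale c (form_scale e x) = form_scale (c * e) x.
Proof. by case: x => ? ? ? ?; rewrite /= !scalerA. Qed.

Lemma form_scale1 : left_id 1 form_scale.
Proof. by case=> ? ? ? ?; rewrite /= !scale1r. Qed.

Lemma form_scaleDr : right_distributive form_scale +%R.
Proof. by move=> c [? ? ? ?] [? ? ? ?]; congr Form; rewrite scalerDr. Qed.

Lemma form_scaleDl x : {morph form_scale^~ x : c e / c + e}.
Proof. by case: x => ? ? ? ? c e; congr Form; rewrite scalerDl. Qed.

HB.instance Definition _ := GRing.Zmodule_isLmodule.Build F Om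
  form_scaleA form_scale1 form_scaleDr form_scaleDl.

(* Decides equality of sums in a Z-module up to associativity and
   commutativity, provided the summands are pairwise distinct. *)
Ltac zsum :=
  rewrite -[LHS]addr0 -[RHS]addr0 -?addrA;
  repeat match goal with
  | |- ?x + _ = _ => rewrite ?[in RHS](addrCA _ x); congr (_ + _)
  end.

Lemma form_mulA : associative form_mul.
Proof.
case=> a0 a1 a2 a3 [] b0 b1 b2 b3 [] c0 c1 c2 c3.
congr Form.
- exact: mulrA.
- by rewrite mulrDl mulrDr !mulrA addrA.
- by rewrite mulrDl mulrDr !mulrA addrA.
- rewrite !(mulrDl, mulrDr, mulrBl, mulrBr, scalerDr, opprD) ?mulNr ?mulrN.
  by rewrite -?scalerAl -?scalerAr ?mulrA; zsum.
Qed.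

Lemma form_mul1l : left_id form_one form_mul.
Proof.
by case=> ? ? ? ?; rewrite /= !mul0r !mul1r !addr0 scaler0 !subr0.
Qed.

Lemma form_mul1r : right_id form_one form_mul.
Proof.
by case=> ? ? ? ?; rewrite /= !mulr0 !mulr1 !add0r addr0 scaler0 !subr0.
Qed.

Lemma form_mulDl : left_distributive form_mul +%R.
Proof.
case=> a0 a1 a2 a3 [] b0 b1 b2 b3 [] c0 c1 c2 c3.
congr Form; rewrite !mulrDl ?scalerDr ?opprD; by zsum.
Qed.

Lemma form_mulDr : right_distributive form_mul +%R.
Proof.
case=> a0 a1 a2 a3 [] b0 b1 b2 b3 [] c0 c1 c2 c3.
congr Form; rewrite !mulrDr ?scalerDr ?opprD; by zsum.
Qed.

Lemma form_1neq0 : form_one != 0.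
Proof. by apply/eqP; case; apply/eqP/oner_neq0. Qed.

HB.instance Definition _ := GRing.Zmodule_isNzRing.Build Om
  form_mulA form_mul1l form_mul1r form_mulDl form_mulDr form_1neq0.

Lemma form_scaleAl c (x y : Om) : c *: (x * y) = (c *: x) * y.
Proof.
case: x y => a0 a1 a2 a3 [b0 b1 b2 b3]; congr Form;
  rewrite ?scalerBr ?scalerDr ?scalerAl //.
by rewrite [c *: (lam *: _)]scalerA mulrC -scalerA -!scalerAl.
Qed.

HB.instance Definition _ := GRing.Lmodule_isLalgebra.Build F Om form_scaleAl.

Lemma form_scaleAr c (x y : Om) : c *: (x * y) = x * (c *: y).
Proof.
case: x y => a0 a1 a2 a3 [b0 b1 b2 b3]; congr Form;
  rewrite ?scalerBr ?scalerDr ?scalerAr //.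
by rewrite [c *: (lam *: _)]scalerA mulrC -scalerA -!scalerAr.
Qed.

HB.instance Definition _ := GRing.Lalgebra_isAlgebra.Build F Om form_scaleAr.

(* The inclusion of A as the forms of degree 0. *)
Definition form0 (a : A) : Om := Form a 0 0 0.

Lemma form0D : {morph form0 : a b / a + b}.
Proof. by move=> a b; congr Form; rewrite addr0. Qed.

Lemma form0M : {morph form0 : a b / a * b}.
Proof.
by move=> a b; congr Form; rewrite !(mulr0, mul0r, scaler0, subr0, addr0).
Qed.

Lemma form0Z c a : form0 (c *: a) = c *: form0 a.
Proof. by congr Form; rewrite scaler0. Qed.

Lemma form01 : form0 1 = 1. Proof. by []. Qed.

Lemma form0B : {morph form0 : a b / a - b}.
Proof. by move=> a b; congr Form; rewrite subr0. Qed.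

Definition basis1 : Om := Form 0 1 0 0.
Definition basis2 : Om := Form 0 0 1 0.


Ltac form_simp := congr Form; rewrite ?(mulr0, mul0r, mulr1, mul1r, scaler0,
  oppr0, subr0, addr0, add0r) //.

Lemma form0_basis1 a : form0 a * basis1 = Form 0 a 0 0.
Proof. by form_simp. Qed.

Lemma basis1_form0 a : basis1 * form0 a = Form 0 a 0 0.
Proof. by form_simp. Qed.

Lemma form0_basis2 a : form0 a * basis2 = Form 0 0 a 0.
Proof. by form_simp. Qed.

Lemma basis2_form0 a : basis2 * form0 a = Form 0 0 a 0.
Proof. by form_simp. Qed.

Lemma basis12 : basis1 * basis2 = Form 0 0 0 1.
Proof. by form_simp. Qed.

Lemma form0_mul a b0 b1 b2 b3 :
  form0 a * Form b0 b1 b2 b3 = Form (a * b0) (a * b1) (a * b2) (a * b3) :> Om.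
Proof. by form_simp. Qed.

Lemma mul_form0 a b0 b1 b2 b3 :
  Form b0 b1 b2 b3 * form0 a = Form (b0 * a) (b1 * a) (b2 * a) (b3 * a) :> Om.
Proof. by form_simp. Qed.

Lemma form_addE a0 a1 a2 a3 b0 b1 b2 b3 :
  Form a0 a1 a2 a3 + Form b0 b1 b2 b3 =
  Form (a0 + b0) (a1 + b1) (a2 + b2) (a3 + b3) :> Om.
Proof. by []. Qed.

Lemma form_oppE a0 a1 a2 a3 :
  - Form a0 a1 a2 a3 = Form (- a0) (- a1) (- a2) (- a3) :> Om.
Proof. by []. Qed.

Lemma form_scaleE c a0 a1 a2 a3 :
  c *: Form a0 a1 a2 a3 = Form (c *: a0) (c *: a1) (c *: a2) (c *: a3) :> Om.
Proof. by []. Qed.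

(* Products of the 1-forms with coefficients (a1, a2) and (b1, b2). *)
Lemma form_mul11 a1 a2 b1 b2 :
  Form 0 a1 a2 0 * Form 0 b1 b2 0 =
  Form 0 0 0 (a1 * b2 - a2 * b1 - lam *: (a2 * b2)) :> Om.
Proof. by form_simp. Qed.

(* The exterior derivative on A is the derivation d with d r = basis1 and
   d t = r^-1 (basis2 + t basis1), computed on expressions. *)

Local Notation r := (gen_r lam).
Local Notation ri := (gen_ri lam).
Local Notation t := (gen_t lam).

Fixpoint dexpr (x : bicross_expr F) : Om :=
  match x with
  | EGenR => basis1
  | EGenRi => - (form0 ri * basis1 * form0 ri)
  | EGenT => form0 ri * (basis2 + form0 t * basis1)
  | EConst _ => 0
  | EAdd y z => dexpr y + dexpr z
  | EMul y z => dexpr y * form0 (bicross_class lam z)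
                + form0 (bicross_class lam y) * dexpr z
  end.

Definition dfun (a : A) : Om := dexpr (repr a).

Lemma comm_t_ri : t * ri - ri * t = lam *: ri.
Proof.
have E : ri * (r * t - t * r) * ri = lam *: ri.
  by rewrite comm_r_t -scalerAr mul_ri_r -scalerAl mul1r.
rewrite -E mulrBr mulrBl !mulrA mul_ri_r mul1r -[_ * r * _]mulrA.
by rewrite mul_r_ri mulr1.
Qed.

Lemma dexpr_t : dexpr EGenT = Form 0 (ri * t) ri 0.
Proof.
rewrite /= mulrDr mulrA -form0M form0_basis1 form0_basis2 form_addE.
by form_simp.
Qed.

Lemma dexpr_ri : dexpr EGenRi = Form 0 (- (ri * ri)) 0 0.
Proof.
rewrite /= form0_basis1 mul_form0 form_oppE.
by form_simp.
Qed.

Lemma form0_class_const c : form0 (bicross_class lam (EConst c)) = c%:A.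
Proof. by rewrite bicross_constE form0Z. Qed.

Lemma dexpr_cong x y : bicross_cong lam x y -> dexpr x = dexpr y.
Proof.
elim=> {x y}; try by [].
- by move=> x y z _ -> _ ->.
- by move=> x x' y y' _ /= -> _ ->.
- move=> x x' y y' xx' /= -> yy' ->.
  by move/bicross_classP: xx' => ->; move/bicross_classP: yy' => ->.
- by move=> x y z /=; rewrite addrA.
- by move=> x y /=; rewrite addrC.
- by move=> x /=; rewrite add0r.
- move=> x /=; rewrite mul0r add0r form0_class_const mulr_algl scaleN1r.
  by rewrite addNr.
- move=> x y z /=; rewrite !bicross_classM !form0M !mulrDl !mulrDr !mulrA.
  by rewrite addrA.
- by move=> x /=; rewrite mul0r add0r form0_class_const mulr_algl scale1r.
- by move=> x /=; rewrite mulr0 addr0 form0_class_const mulr_algr scale1r.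
- move=> x y z /=; rewrite !bicross_classD !form0D ?mulrDl ?mulrDr.
  by rewrite addrACA.
- move=> x y z /=; rewrite !bicross_classD !form0D ?mulrDl ?mulrDr.
  by rewrite addrACA.
- by move=> a b /=; rewrite addr0.
- by move=> a b /=; rewrite mul0r mulr0 addr0.
- move=> a x /=; rewrite mul0r mulr0 add0r addr0 form0_class_const.
  by rewrite mulr_algl mulr_algr.
- rewrite /= -[- _]/(dexpr EGenRi) dexpr_ri basis1_form0 form0_mul form_addE.
  rewrite -[bicross_class lam EGenR]/r -[bicross_class lam EGenRi]/ri.
  by form_simp; rewrite mulrN mulrA mul_r_ri mul1r subrr.
- rewrite /= -[- _]/(dexpr EGenRi) dexpr_ri form0_basis1 mul_form0 form_addE.
  rewrite -[bicross_class lam EGenR]/r -[bicross_class lam EGenRi]/ri.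
  by form_simp; rewrite mulNr -mulrA mul_ri_r mulr1 addNr.
- rewrite /= -[form0 ri * _]/(dexpr EGenT) dexpr_t.
  rewrite -[bicross_class lam EGenR]/r -[bicross_class lam EGenT]/t.
  rewrite mul0r add0r form0_class_const mulr_algl basis1_form0 form0_basis1.
  rewrite form0_mul mul_form0 form_scaleE !form_addE.
  form_simp; last by rewrite mul_r_ri mul_ri_r.
  have E : ri * (r * t - t * r) = lam *: 1.
    by rewrite comm_r_t -scalerAr mul_ri_r.
  rewrite -E mulrBr !mulrA mul_r_ri mul_ri_r !mul1r.
  by rewrite [RHS]addrC addrA subrK.
Qed.

Lemma dfun_class x : dfun (bicross_class lam x) = dexpr x.
Proof. exact/dexpr_cong/repr_bicross_class. Qed.

Lemma dfunD : {morph dfun : a b / a + b}.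
Proof.
elim/bicross_ind=> x; elim/bicross_ind=> y.
by rewrite -bicross_classD !dfun_class.
Qed.

Lemma dfunM a b : dfun (a * b) = dfun a * form0 b + form0 a * dfun b.
Proof.
elim/bicross_ind: a => x; elim/bicross_ind: b => y.
by rewrite -bicross_classM !dfun_class.
Qed.

Lemma dfun_alg c : dfun c%:A = 0.
Proof. by rewrite -bicross_constE dfun_class. Qed.

Lemma dfunZ c a : dfun (c *: a) = c *: dfun a.
Proof.
by rewrite -mulr_algl dfunM dfun_alg mul0r add0r form0Z mulr_algl.
Qed.

Lemma dfun_r : dfun r = basis1.
Proof. exact: dfun_class. Qed.

Lemma dfun_t : dfun t = Form 0 (ri * t) ri 0.
Proof. by rewrite dfun_class dexpr_t. Qed.

Lemma dfun_ri : dfun ri = Form 0 (- (ri * ri)) 0 0.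
Proof. by rewrite dfun_class dexpr_ri. Qed.

Lemma comm_r_dt : form0 r * dfun t - dfun t * form0 r = lam *: dfun r.
Proof.
rewrite dfun_r dfun_t form0_mul mul_form0 form_oppE form_scaleE form_addE.
form_simp; last by rewrite mul_r_ri mul_ri_r subrr.
have E : ri * (r * t - t * r) = lam *: 1.
  by rewrite comm_r_t -scalerAr mul_ri_r.
by rewrite -E mulrBr !mulrA mul_r_ri mul_ri_r mul1r.
Qed.

Lemma comm_t_dt : form0 t * dfun t - dfun t * form0 t = lam *: dfun t.
Proof.
rewrite dfun_t form0_mul mul_form0 form_oppE form_scaleE form_addE.
form_simp; last by rewrite comm_t_ri.
by rewrite mulrA -mulrBl comm_t_ri scalerAl.
Qed.

Lemma comm_r_dr : form0 r * dfun r - dfun r * form0 r = 0.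
Proof. by rewrite dfun_r form0_basis1 basis1_form0 subrr. Qed.

Lemma comm_t_dr : form0 t * dfun r - dfun r * form0 t = 0.
Proof. by rewrite dfun_r form0_basis1 basis1_form0 subrr. Qed.

Definition e1 : Om := dfun r.
Definition e2 : Om := form0 r * dfun t - form0 t * dfun r.
Definition Vol : Om := e1 * e2.

Lemma e1E : e1 = Form 0 1 0 0.
Proof. exact: dfun_r. Qed.

Lemma e2E : e2 = Form 0 0 1 0.
Proof.
rewrite /e2 dfun_r dfun_t !form0_mul form_oppE form_addE.
form_simp; last by rewrite mul_r_ri.
by rewrite mulrA mul_r_ri mul1r subrr.
Qed.

Lemma VolE : Vol = Form 0 0 0 1.
Proof. by rewrite /Vol e1E e2E basis12. Qed.

(* Every form is a unique left A-combination of 1, e1, e2, Vol. *)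
Lemma form_basisE a0 a1 a2 a3 :
  Form a0 a1 a2 a3 =
  form0 a0 + form0 a1 * e1 + form0 a2 * e2 + form0 a3 * Vol.
Proof.
by rewrite e1E e2E VolE !form0_mul !form_addE; form_simp.
Qed.

Lemma e1_central a : e1 * form0 a = form0 a * e1.
Proof. by rewrite e1E basis1_form0 form0_basis1. Qed.

Lemma e2_central a : e2 * form0 a = form0 a * e2.
Proof. by rewrite e2E basis2_form0 form0_basis2. Qed.

Lemma e1_sqr : e1 * e1 = 0.
Proof. by rewrite e1E form_mul11; form_simp. Qed.

Lemma e2_sqr : e2 * e2 = - lam *: Vol.
Proof.
by rewrite e2E VolE form_mul11 form_scaleE; form_simp; rewrite scaleNr.
Qed.

Lemma e12_anti : e1 * e2 + e2 * e1 = 0.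
Proof. by rewrite e1E e2E !form_mul11 form_addE; form_simp; rewrite subrr. Qed.

(* The homogeneous forms of degree n; there are none but 0 for n > 2. *)
Definition homog (n : nat) (w : Om) : Prop :=
  match n with
  | 0 => exists a, w = form0 a
  | 1 => exists a1 a2, w = form0 a1 * e1 + form0 a2 * e2
  | 2 => exists a, w = form0 a * Vol
  | _ => w = 0
  end.

(* The exterior derivative on all forms; d e2 = 2 dr dt = 2 r^-1 Vol. *)
Definition dform (w : Om) : Om :=
  dfun (coef0 w) + dfun (coef1 w) * e1 + dfun (coef2 w) * e2
  + form0 (coef2 w * ri *+ 2) * Vol.

Lemma homog1E w : homog 1 w <-> exists a1 a2, w = Form 0 a1 a2 0.
Proof.
split=> -[a1 [a2 ->]]; exists a1, a2.
  by rewrite e1E e2E !form0_mul form_addE; form_simp.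
by rewrite form_basisE /form0 -[Form 0 0 0 0]/(0 : Om) mul0r add0r addr0.
Qed.

Lemma homog2E w : homog 2 w <-> exists a, w = Form 0 0 0 a.
Proof. by split=> -[a ->]; exists a; rewrite VolE form0_mul; form_simp. Qed.

Lemma dexpr_homog x : homog 1 (dexpr x).
Proof.
apply/homog1E.
elim: x => [||| c | y [a1 [a2 IHy]] z [b1 [b2 IHz]]
               | y [a1 [a2 IHy]] z [b1 [b2 IHz]]].
- by exists 1, 0.
- by rewrite dexpr_ri; eexists; eexists.
- by rewrite dexpr_t; eexists; eexists.
- by exists 0, 0.
- by rewrite /= IHy IHz form_addE addr0; eexists; eexists.
- rewrite /= IHy IHz mul_form0 form0_mul form_addE !(mul0r, mulr0, addr0).
  by eexists; eexists.
Qed.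

Lemma dfunE a : dfun a = Form 0 (coef1 (dfun a)) (coef2 (dfun a)) 0.
Proof. by rewrite /dfun; have /homog1E[a1 [a2 ->]] := dexpr_homog (repr a). Qed.

Lemma dfun0 : dfun 0 = 0.
Proof. by rewrite -(scale0r 0) dfunZ scale0r. Qed.

Lemma dform0 a : dform (form0 a) = dfun a.
Proof. by rewrite /dform /= dfun0 !mul0r mul0rn mul0r !addr0. Qed.

Lemma dformE b0 b1 b2 b3 : dform (Form b0 b1 b2 b3) =
  Form 0 (coef1 (dfun b0)) (coef2 (dfun b0))
    (- coef2 (dfun b1) + (coef1 (dfun b2) - lam *: coef2 (dfun b2))
     + (b2 * ri + b2 * ri)).
Proof.
rewrite /dform /= (dfunE b0) (dfunE b1) (dfunE b2) e1E e2E VolE.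
rewrite !form_mul11 form0_mul !form_addE /=.
by form_simp; rewrite !mulr0 !mulr1 !sub0r mulr2n.
Qed.

Lemma dform1 a1 a2 : dform (Form 0 a1 a2 0) = Form 0 0 0
  (- coef2 (dfun a1) + (coef1 (dfun a2) - lam *: coef2 (dfun a2))
   + (a2 * ri + a2 * ri)).
Proof. by rewrite dformE dfun0. Qed.

Lemma dform2 a : dform (Form 0 0 0 a) = 0.
Proof. by rewrite dformE dfun0; form_simp. Qed.

Lemma dform_linear c x y : dform (c *: x + y) = c *: dform x + dform y.
Proof.
case: x => a0 a1 a2 a3; case: y => b0 b1 b2 b3.
rewrite form_scaleE form_addE /dform /= !(dfunD, dfunZ).
rewrite !mulrDl mulrnDl form0D mulrDl -!scalerAl scalerMnr form0Z -scalerAl.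
by rewrite !scalerDr; zsum.
Qed.

Lemma dform_homog n x : homog n x -> homog n.+1 (dform x).
Proof.
case: n => [|[|[|n]]].
- by case=> a ->; rewrite dform0; exact: dexpr_homog.
- by case/homog1E=> a1 [a2 ->]; rewrite dform1; apply/homog2E; eexists.
- by case/homog2E=> a ->; rewrite dform2.
- by move=> ->; rewrite -[0]/(form0 0) dform0 dfun0.
Qed.

Lemma coef1_dfunM a b :
  coef1 (dfun (a * b)) = coef1 (dfun a) * b + a * coef1 (dfun b).
Proof. by rewrite dfunM (dfunE a) (dfunE b) mul_form0 form0_mul. Qed.

Lemma coef2_dfunM a b :
  coef2 (dfun (a * b)) = coef2 (dfun a) * b + a * coef2 (dfun b).
Proof. by rewrite dfunM (dfunE a) (dfunE b) mul_form0 form0_mul. Qed.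

Lemma comm_ri a : a * ri - ri * a = lam *: coef2 (dfun a).
Proof.
elim/bicross_ind: a => x.
elim: x => [||| c | y IHy z IHz | y IHy z IHz].
- by rewrite -/r dfun_r mul_r_ri mul_ri_r subrr scaler0.
- by rewrite -/ri dfun_ri subrr scaler0.
- by rewrite -/t dfun_t comm_t_ri.
- by rewrite bicross_constE dfun_alg mulr_algl mulr_algr subrr scaler0.
- rewrite bicross_classD dfunD mulrDl mulrDr (dfunE (_ y)) (dfunE (_ z)).
  by rewrite scalerDr -IHy -IHz; rewrite opprD addrACA.
- rewrite bicross_classM coef2_dfunM scalerDr scalerAl scalerAr -IHy -IHz.
  by rewrite mulrBl mulrBr !mulrA [RHS]addrC subrKA.
Qed.

Lemma form_mulE a0 a1 a2 a3 b0 b1 b2 b3 :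
  Form a0 a1 a2 a3 * Form b0 b1 b2 b3 =
  Form (a0 * b0) (a0 * b1 + a1 * b0) (a0 * b2 + a2 * b0)
    (a0 * b3 + a3 * b0 + a1 * b2 - a2 * b1 - lam *: (a2 * b2)) :> Om.
Proof. by []. Qed.

Lemma dform_leibniz n x y : homog n x ->
  dform (x * y) = dform x * y + (-1) ^+ n * (x * dform y).
Proof.
case: y => c0 c1 c2 c3; case: n => [|[|[|n]]].
- case=> a ->; rewrite expr0 mul1r dform0 form0_mul !dformE form0_mul.
  rewrite !(coef1_dfunM, coef2_dfunM) (dfunE a).
  congr Form; rewrite !(mul0r, mulr0, addr0, add0r, scaler0) //.
  rewrite !(mulrDl, mulrDr, mulrN, scalerDr, opprD) -?scalerAr -?scalerAl.
  by rewrite !mulrA; zsum.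
- case/homog1E=> a1 [a2 ->]; rewrite expr1 mulN1r dform1 dformE.
  rewrite !form_mulE dformE form_oppE form_addE.
  rewrite !(mul0r, mulr0, addr0, add0r, subr0, oppr0, scaler0, dfun0) /=.
  rewrite !(coef1_dfunM, coef2_dfunM); congr Form.
  set u := lam *: (a2 * coef2 (dfun c0)); set v := a2 * ri * c0 + a2 * ri * c0.
  have -> : a2 * c0 * ri + a2 * c0 * ri = u + (v + u).
    have -> : a2 * c0 * ri = a2 * ri * c0 + u.
      by rewrite /u scalerAr -comm_ri mulrBr !mulrA [RHS]addrC subrK.
    by rewrite /v addrACA [RHS]addrCA.
  rewrite !mulrDl -/v !(mulrDl, mulrDr, mulrN, mulNr, scalerDr, opprD) ?opprK.
  rewrite -?scalerAr -?scalerAl ?mulrA -/u.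
  move: u v => u v; move ET: (u + (v + u)) => T; rewrite ?addrA -{}ET addrA subrK.
  by rewrite ?addrA; zsum.
- case/homog2E=> a ->; rewrite dform2 mul0r add0r form_mulE !dformE form_mulE.
  rewrite !(mul0r, mulr0, addr0, add0r, subr0, oppr0, scaler0, dfun0) /=.
  by [].
- move=> ->; have -> : dform 0 = 0 by rewrite -[0]/(form0 0) dform0 dfun0.
  by rewrite !mul0r mulr0 addr0 -[0]/(form0 0) dform0 dfun0.
Qed.

Lemma dform_dform x : dform (dform x) = 0.
Proof.
suff E a : dform (dfun a) = 0.
  case: x => a0 a1 a2 a3; rewrite dformE; have := E a0.
  by rewrite (dfunE a0) !dformE dfun0 /=.
elim/bicross_ind: a => {}x; rewrite dfun_class.
have H y : homog 0 (form0 (bicross_class lam y)) by eexists.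
have H1 y : homog 1 (dexpr y) by exact: dexpr_homog.
have D y z : dform (y + z) = dform y + dform z.
  by rewrite -{1}[y]scale1r dform_linear scale1r.
elim: x => [||| c | y IHy z IHz | y IHy z IHz].
- have d1 : dfun 1 = 0 by rewrite -[1]scale1r dfun_alg.
  rewrite [dexpr _]/basis1 dform1 d1 dfun0 /= !(mul0r, oppr0, scaler0, addr0).
  by [].
- rewrite dexpr_ri dform1 -(scaleN1r (ri * ri)) dfunZ (dfunE (ri * ri)) coef2_dfunM.
  rewrite dfun_ri dfun0 /= !(mul0r, mulr0, oppr0, scaler0, addr0).
  by [].
- rewrite dexpr_t dform1 coef2_dfunM dfun_ri dfun_t /=.
  rewrite !(mul0r, add0r, scaler0, oppr0, addr0) addrACA addNr addr0.
  by [].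
- by rewrite -[dexpr _]/(form0 0) dform0 dfun0.
- by rewrite D IHy IHz addr0.
- rewrite D (dform_leibniz _ (H1 y)) (dform_leibniz _ (H y)) IHy IHz !dform0.
  rewrite mul0r add0r !mulr0 addr0 expr1 !dfun_class mulN1r.
  by rewrite addNr.
Qed.

(* The bimodule-map conditions, including A-balancedness, say that perp
   factors through the tensor product of Omega with itself over A. *)
Record four_term_solution (perp : Om -> Om -> Om) : Prop := FourTermSolution {
  perp_linearl : forall y, linear (perp^~ y);
  perp_linearr : forall x, linear (perp x);
  perp_degree : forall m n x y, homog m x -> homog n y ->
    if (m + n < 2)%N then perp x y = 0 else homog (m + n - 2) (perp x y);
  perp_mull : forall a x y, perp (form0 a * x) y = form0 a * perp x y;
  perp_mulr : forall a x y, perp x (y * form0 a) = perp x y * form0 a;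
  perp_balanced : forall a x y, perp (x * form0 a) y = perp x (form0 a * y);
  perp_form0l : forall a x, perp (form0 a) x = 0;
  perp_form0r : forall a x, perp x (form0 a) = 0;
  perp_four_term : forall m n p x y z,
    homog m x -> homog n y -> homog p z ->
    (-1) ^+ n * perp (x * y) z + perp x y * z =
    perp x (y * z) + (-1) ^+ (m + n) * (x * perp y z) }.

Record four_term_form (b : F) (perp : Om -> Om -> Om) : Prop := FourTermForm {
  perp_Vol_e1 : perp Vol e1 = b *: e1;
  perp_Vol_e2 : perp Vol e2 = b *: e2;
  perp_e1_Vol : - perp e1 Vol = b *: e1;
  perp_e2_Vol : - perp e2 Vol = b *: e2;
  perp_e1_e1 : perp e1 e1 = 0;
  perp_e1_e2 : perp e1 e2 = b%:A;
  perp_e2_e1 : perp e2 e1 = - b%:A;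
  perp_e2_e2 : perp e2 e2 = (- lam * b)%:A;
  perp_Vol_Vol : perp Vol Vol = (2 * b) *: Vol }.

End Forms.

(* Main.v *)
(* For [lambda <> 0] the center of the algebra consists of the constants: every
   element is a sum of terms [f(t) r^k]; commuting with [t] forces [k = 0], and
   commuting with [r] makes [f] periodic, hence constant. Since [e1], [e2] and
   [Vol] are central, so are the values [ei _|_ ej]; the 4-term relations in
   degrees (1,1,1) and (2,1,1) then determine everything from [e1 _|_ e2]. *)

Require Import Defs.
From mathcomp Require Import all_boot all_order all_algebra.
From mathcomp Require Import boolp reals complex.

Import Order.TTheory GRing.Theory Num.Theory.
Local Open Scope ring_scope.

Set Implicit Arguments.
Unset Strict Implicit.
Unset Printing Implicit Defensive.

(** * Commutation rules and Laurent sums in r over polynomials in t *)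

Section Center.
Variables (F : fieldType) (lam : F).

Local Notation A := (bicross lam).
Local Notation r := (gen_r lam).
Local Notation ri := (gen_ri lam).
Local Notation t := (gen_t lam).

Lemma mul_r_t : r * t = (t + lam%:A) * r.
Proof. by rewrite mulrDl mulr_algl -comm_r_t addrC subrK. Qed.

Lemma mul_ri_t : ri * t = (t - lam%:A) * ri.
Proof. by rewrite mulrBl mulr_algl -comm_t_ri opprB addrC subrK. Qed.

(** By induction on the Horner form: moving [u] across a factor t replaces it by t + c. This serves
    for [u = r] with [c = lam] and for [u = ri] with [c = - lam]. *)
Lemma mul_horner_t (u : A) c : u * t = (t + c%:A) * u ->
  forall f : {poly F},
    u * horner_alg t f = horner_alg t (f \Po ('X + c%:P)) * u.
Proof.
move=> ut; elim/poly_ind=> [|f d IHf]; first by rewrite comp_poly0 !rmorph0 mul0r mulr0.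
rewrite comp_polyD comp_polyM comp_polyX comp_polyC !rmorphD !rmorphM rmorphD /=.
rewrite !horner_algX !horner_algC mulrDr mulrDl mulrA IHf -!mulrA ut.
by rewrite mulr_algl mulr_algr.
Qed.

Definition rpow (k : int) : A :=
  match k with Posz n => r ^+ n | Negz n => ri ^+ n.+1 end.

Lemma mul_r_rpow k : r * rpow k = rpow (k + 1).
Proof.
case: k => [n|[|n]] /=; first by rewrite addn1 exprS.
  by rewrite expr1 mul_r_ri.
by rewrite exprS mulrA mul_r_ri mul1r subn1.
Qed.

Lemma mul_ri_rpow k : ri * rpow k = rpow (k - 1).
Proof.
case: k => [[|n]|n] /=; first by rewrite mulr1 expr1.
  by rewrite exprS mulrA mul_ri_r mul1r subn1.
by rewrite -exprS addn0.
Qed.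

(** Read as [r^k, t] = k lam r^k, this makes the powers of r eigenvectors of the commutator with t,
    so that commutators can separate them. *)
Lemma rpow_t k : rpow k * t = (t + (k%:~R * lam)%:A) * rpow k.
Proof.
have rn n : r ^+ n * t = (t + (n%:R * lam)%:A) * r ^+ n.
  elim: n => [|n IHn]; first by rewrite mul0r scale0r addr0 mulr1 mul1r.
  rewrite exprS -mulrA IHn mulrA mulrDr mul_r_t mulr_algr -(mulr_algl _ r) -mulrDl.
  by rewrite -addrA -scalerDl -mulrA -nat1r (mulrDl 1) mul1r.
have rin n : ri ^+ n * t = (t - (n%:R * lam)%:A) * ri ^+ n.
  elim: n => [|n IHn]; first by rewrite mul0r scale0r subr0 mulr1 mul1r.
  rewrite exprS -mulrA IHn mulrA mulrBr mul_ri_t mulr_algr -(mulr_algl _ ri) -mulrBl.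
  by rewrite -addrA -opprD -scalerDl -mulrA -nat1r (mulrDl 1) mul1r.
case: k => [n|n] /=; first exact: rn.
by rewrite rin NegzE mulrNz mulNr scaleNr.
Qed.

(** Exponents may repeat, so that concatenating lists adds the elements. *)
Definition laurent (s : seq (int * {poly F})) : A :=
  \sum_(p <- s) horner_alg t p.2 * rpow p.1.

(** Left multiplication by a generator or a constant acts termwise on such sums. The induction on
    expressions is stated for this left action, so that a product becomes a composition; acting on
    the sum 1 gives the claim. *)
Lemma laurent_span a : exists s, a = laurent s.
Proof.
have sum_map (u : A) (h : int * {poly F} -> int * {poly F}) :
    (forall k f, u * (horner_alg t f * rpow k) =
       horner_alg t (h (k, f)).2 * rpow (h (k, f)).1) ->
    forall s, exists s', u * laurent s = laurent s'.
  move=> uh s; exists [seq h p | p <- s].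
  rewrite /laurent big_map mulr_sumr; apply: eq_bigr => -[k f] _; exact: uh.
suff H x s : exists s', bicross_class lam x * laurent s = laurent s'.
  elim/bicross_ind: a => x; have [s' E] := H x [:: (0, 1)].
  by exists s'; rewrite -E /laurent big_seq1 rmorph1 !mulr1.
elim: x s => [||| c | y IHy z IHz | y IHy z IHz] s.
- apply: (sum_map _ (fun p => (p.1 + 1, p.2 \Po ('X + lam%:P)))) => k f /=.
  by rewrite mulrA (mul_horner_t mul_r_t) -mulrA mul_r_rpow.
- apply: (sum_map _ (fun p => (p.1 - 1, p.2 \Po ('X + (- lam)%:P)))) => k f /=.
  rewrite mulrA (mul_horner_t (c := - lam)) ?scaleNr ?mul_ri_t //.
  by rewrite -mulrA mul_ri_rpow.
- apply: (sum_map _ (fun p => (p.1, 'X * p.2))) => k f /=.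
  by rewrite rmorphM /= horner_algX -mulrA.
- apply: (sum_map _ (fun p => (p.1, c%:P * p.2))) => k f /=.
  by rewrite rmorphM /= horner_algC bicross_constE -mulrA.
- have [s1 E1] := IHy s; have [s2 E2] := IHz s; exists (s1 ++ s2).
  by rewrite bicross_classD mulrDl E1 E2 /laurent big_cat.
- have [s1 E1] := IHz s; have [s2 E2] := IHy s1; exists s2.
  by rewrite bicross_classM -mulrA E1 E2.
Qed.

(** * The shift representation on functions of an integer *)

Definition shift_act (a : A) := bicross_shift lam (repr a).

Lemma shift_act_class x : shift_act (bicross_class lam x) = bicross_shift lam x.
Proof. exact/bicross_shift_cong/repr_bicross_class. Qed.

Lemma shift_actM a b g : shift_act (a * b) g = shift_act a (shift_act b g).
Proof.
elim/bicross_ind: a => x; elim/bicross_ind: b => y.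
by rewrite -bicross_classM !shift_act_class.
Qed.

(** Since t acts diagonally with eigenvalues n lam, identities in A involving polynomials in t
    become identities between their values at these points. *)
Lemma shift_act_horner f g n :
  shift_act (horner_alg t f) g n = f.[lam *~ n] * g n.
Proof.
elim/poly_ind: f g => [|f c IHf] g.
  by rewrite rmorph0 -(scale0r 1) -bicross_constE shift_act_class horner0.
rewrite rmorphD rmorphM /= horner_algX horner_algC.
set u := horner_alg t f in IHf *.
have -> : shift_act (u * t + c%:A) g n = shift_act (u * t) g n + c * g n.
  elim/bicross_ind: (u * t) => x.
  by rewrite -bicross_constE -bicross_classD !shift_act_class.
by rewrite shift_actM IHf shift_act_class /= hornerD hornerMX hornerC mulrDl mulrA.
Qed.

(** * The centralizer of t and the center, in characteristic 0 *)

Hypothesis charF : [pchar F] =i pred0.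
Hypothesis lam_neq0 : lam != 0.

Lemma intr_neq0_pchar0 (k : int) : k != 0 -> k%:~R != 0 :> F.
Proof.
have /pcharf0P natF := charF.
by case: k => [n|n] nz; rewrite ?NegzE ?mulrNz ?oppr_eq0 natF.
Qed.

(* If [k] is nonzero then [a |-> a - (k lam)^-1 (a t - t a)] fixes the
   centralizer of [t] and kills the component of degree [k] in [r]. *)
Lemma centralizer_t a : a * t = t * a -> exists f, a = horner_alg t f.
Proof.
move=> at_ta; have [s] := laurent_span a; rewrite -[laurent s]addr0 -(rmorph0 (horner_alg t)).
(* The polynomial 0 is generalized to a [g] that absorbs the terms of exponent 0. The induction is
   on a bound for the number of terms, since the tail is replaced by a rescaled list. *)
move: {2}(size s) (leqnn (size s)) 0 => n.
elim: n s => [|n IHn] [|[k f] s] //= sn g aE.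
- by exists g; rewrite aE /laurent big_nil add0r.
- by exists g; rewrite aE /laurent big_nil add0r.
move: aE; rewrite /laurent big_cons -/(laurent s) /= => aE.
have [k0|k_neq0] := eqVneq k 0.
  apply: (IHn s sn (f + g)).
  by rewrite aE k0 mulr1 rmorphD addrAC addrC.
pose c := (k%:~R * lam)^-1.
have c_neq0 : k%:~R * lam != 0 by rewrite mulf_neq0 ?intr_neq0_pchar0.
pose T (u : A) := u - c *: (u * t - t * u).
have TD u v : T (u + v) = T u + T v.
  by rewrite /T mulrDl mulrDr opprD addrACA scalerDr opprD addrACA.
have ht h : horner_alg t h * t = t * horner_alg t h.
  by rewrite -{2 3}(horner_algX t) -!rmorphM mulrC.
have Thorner h : T (horner_alg t h) = horner_alg t h.
  by rewrite /T ht subrr scaler0 subr0.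
have Tterm h j : T (horner_alg t h * rpow j) =
    horner_alg t ((1 - c * (j%:~R * lam)) *: h) * rpow j.
  have -> : T (horner_alg t h * rpow j) = horner_alg t h * rpow j -
      c *: ((j%:~R * lam) *: (horner_alg t h * rpow j)).
    congr (_ - _ *: _); rewrite -mulrA rpow_t mulrDl mulrDr !mulrA ht.
    by rewrite addrAC subrr add0r mulr_algr scalerAl.
  by rewrite scalerA [in RHS]linearZ /= -scalerAl scalerBl scale1r mul1r mulrBl -scalerAl.
have Ta : T a = a by rewrite /T at_ta subrr scaler0 subr0.
apply: (IHn [seq (p.1, (1 - c * (p.1%:~R * lam)) *: p.2) | p <- s] _ g).
  by rewrite size_map.
rewrite -[LHS]Ta aE !TD Tterm mulVf // subrr scale0r rmorph0 mul0r add0r Thorner.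
congr (_ + _); rewrite /laurent big_map.
elim: s {sn aE} => [|[j h] s IHs].
  by rewrite !big_nil /T mul0r mulr0 subrr scaler0 subr0.
by rewrite !big_cons TD IHs /= Tterm.
Qed.

Lemma bicross_center (a : A) : (forall b, a * b = b * a) -> exists c, a = c%:A.
Proof.
move=> aC; have [f aE] := centralizer_t (aC t).
(* Let both sides of a r = r a act on the constant function 1 and compare the results at n. *)
have step n : f.[lam *~ (n + 1)] = f.[lam *~ n].
  have /(congr1 (fun b => shift_act b (fun=> 1) n)) := aC r.
  rewrite aE !shift_actM [shift_act r]shift_act_class /= !shift_act_horner.
  by rewrite !mulr1.
have fconst (n : nat) : f.[lam *~ n] = f.[0].
  by elim: n => [|n IHn]; rewrite ?mulr0z // -addn1 PoszD step.
exists f.[0]; rewrite aE -(horner_algC t); congr (horner_alg t _).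
apply/subr0_eq; set g := f - _.
(* These are [size g] distinct roots of [g], more than its degree allows unless [g] is 0. *)
pose s := [seq lam *~ Posz n | n <- iota 0 (size g)].
apply: (@roots_geq_poly_eq0 _ g s).
- by apply/allP => _ /mapP[n _ ->]; rewrite rootE !hornerE fconst subrr.
- rewrite map_inj_uniq ?iota_uniq // => m n /eqP.
  rewrite -subr_eq0 -mulrzBr -mulrzl mulf_eq0 (negPf lam_neq0) orbF.
  apply: contraTeq => mn; apply: intr_neq0_pchar0.
  by rewrite subr_eq0.
- by rewrite size_map size_iota.
Qed.

End Center.

Definition formE := (@form_addE, @form_oppE, @form_scaleE, @form0_mul, @mul_form0).
Definition simp0 :=
  (mulr0, mul0r, mulr1, mul1r, addr0, add0r, subr0, oppr0, scaler0).

(** * Necessity: every solution is governed by one constant *)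

Section FourTerm.
Variables (F : fieldType) (lam : F).

Local Notation A := (bicross lam).
Local Notation Om := (forms lam).
Local Notation e1 := (e1 lam).
Local Notation e2 := (e2 lam).
Local Notation Vol := (Vol lam).

Lemma form0_alg c : form0 c%:A = c%:A :> Om.
Proof. exact: form0Z. Qed.

Lemma homog0 n : homog n (0 : Om).
Proof.
case: n => [|[|[|n]]] //; first by exists 0.
  by apply/homog1E; exists 0, 0.
by apply/homog2E; exists 0.
Qed.

(** Above degree 2 only 0 is left, so the last case forgets the degree. *)
Lemma homog_cases n (x : Om) : homog n x ->
  [\/ n = 0%N /\ exists a, x = form0 a,
      n = 1%N /\ exists a1 a2, x = Form 0 a1 a2 0,
      n = 2%N /\ exists a, x = Form 0 0 0 a | x = 0].
Proof.
case: n => [|[|[|n]]] hx; first exact: Or41.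
- by apply: Or42; split=> //; apply/homog1E.
- by apply: Or43; split=> //; apply/homog2E.
- exact: Or44.
Qed.

Section Solution.
Variable perp : Om -> Om -> Om.
Hypothesis perp_sol : four_term_solution perp.

Lemma perpD_l x y z : perp (x + y) z = perp x z + perp y z.
Proof. by have /= := perp_linearl perp_sol z 1 x y; rewrite !scale1r. Qed.

Lemma perpD_r x y z : perp z (x + y) = perp z x + perp z y.
Proof. by have := perp_linearr perp_sol z 1 x y; rewrite !scale1r. Qed.

Lemma perpZ_l c x y : perp (c *: x) y = c *: perp x y.
Proof. by rewrite -[c *: x]mulr_algl -form0Z (perp_mull perp_sol) form0Z mulr_algl. Qed.

Lemma perpZ_r c x y : perp x (c *: y) = c *: perp x y.
Proof. by rewrite -[c *: y]mulr_algr -form0Z (perp_mulr perp_sol) form0Z mulr_algr. Qed.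

Lemma perp0_l x : perp 0 x = 0.
Proof. exact: perp_form0l perp_sol 0 x. Qed.

Lemma perp0_r x : perp x 0 = 0.
Proof. exact: perp_form0r perp_sol 0 x. Qed.

(** The scalar form travels from right to left: into the second argument, across [y], over to the
    first argument by balancedness, across [x], and out. *)
Lemma perp_central x y a :
  (forall a, x * form0 a = form0 a * x) -> (forall a, y * form0 a = form0 a * y) ->
  perp x y * form0 a = form0 a * perp x y.
Proof.
move=> xC yC.
by rewrite -(perp_mulr perp_sol) yC -(perp_balanced perp_sol) xC (perp_mull perp_sol).
Qed.

Hypothesis charF : [pchar F] =i pred0.
Hypothesis lam_neq0 : lam != 0.

(* The relations for (e1,e1,e2), (e2,e1,e1), (e1,e2,e2), (e2,e2,e1) express
   [ei _|_ Vol] and [Vol _|_ ei] through the [ei _|_ ej]; those for (e2,e1,e2)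
   and (e2,e2,e2) then leave [e1 _|_ e2] as the only parameter. *)
Lemma four_term_solution_form : exists b : F, four_term_form b perp.
Proof.
have h1 : homog 1 e1 by apply/homog1E; exists 1, 0; rewrite e1E.
have h2 : homog 1 e2 by apply/homog1E; exists 0, 1; rewrite e2E.
have hV : homog 2 Vol by apply/homog2E; exists 1; rewrite VolE.
have deg := perp_degree perp_sol.
(* By degree, each ei _|_ ej is an element of A, and Vol _|_ Vol is a multiple of Vol; the [g]s are
   these coefficients. *)
have [g11 E11] := deg _ _ _ _ h1 h1.
have [g12 E12] := deg _ _ _ _ h1 h2.
have [g21 E21] := deg _ _ _ _ h2 h1.
have [g22 E22] := deg _ _ _ _ h2 h2.
have /homog2E [gV EV] := deg _ _ _ _ hV hV.
have FT := perp_four_term perp_sol.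
have e21 : e2 * e1 = - Vol by apply/eqP; rewrite -addr_eq0 addrC e12_anti.
have two_neq0 : 2 != 0 :> F by have /pcharf0P -> := charF.
have perpN_l x y : perp (- x) y = - perp x y.
  by rewrite -scaleN1r perpZ_l scaleN1r.
have perpN_r x y : perp x (- y) = - perp x y.
  by rewrite -scaleN1r perpZ_r scaleN1r.
have FT111 x y z : homog 1 x -> homog 1 y -> homog 1 z ->
    - perp (x * y) z + perp x y * z = perp x (y * z) + x * perp y z.
  by move=> hx hy hz; have := FT _ _ _ _ _ _ hx hy hz; rewrite mulN1r sqrrN expr1n mul1r.
have mv (v g s : Om) : - v + g = s -> v = g - s.
  by move=> <-; rewrite opprD opprK addrCA subrr addr0.
have w1E : perp e1 Vol = Form 0 (- g12) g11 0.
  have := FT111 _ _ _ h1 h1 h2; rewrite -[e1 * e2]/Vol e1_sqr perp0_l E11 E12.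
  rewrite e1_central oppr0 add0r => /eqP; rewrite -subr_eq => /eqP <-.
  by rewrite e1E e2E !formE !simp0.
have v1E : perp Vol e1 = Form 0 (- g21) g11 0.
  have := FT111 _ _ _ h2 h1 h1; rewrite e1_sqr perp0_r E11 E21 e21 e2_central.
  rewrite perpN_l => /mv; rewrite add0r -opprB => /oppr_inj ->.
  by rewrite e1E e2E !formE !simp0.
have v2E : perp Vol e2 = Form 0 (- (lam *: g12) - g22) (lam *: g11 + g12) 0.
  have := FT111 _ _ _ h1 h2 h2; rewrite -[e1 * e2]/Vol e2_sqr perpZ_r E12 E22.
  rewrite e1_central w1E => /mv ->; rewrite e1E e2E scaleNr !formE !simp0.
  by rewrite opprD !opprK scalerN [_ + g12]addrC.
have w2E : perp e2 Vol = Form 0 (lam *: g21 - g22) (g21 - lam *: g11) 0.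
  have := FT111 _ _ _ h2 h2 h1; rewrite e21 e2_sqr perpZ_l perpN_r E21 E22.
  rewrite e2_central v1E => /esym/mv ->; rewrite e1E e2E scaleNr opprK !formE !simp0.
  by rewrite scalerN opprD opprK.
(* The e1-component [E1] will give g21 = - g12, and the e2-component [E2] will give 2 lam g11 =
   0. *)
have := FT111 _ _ _ h2 h1 h2.
rewrite -[e1 * e2]/Vol e21 perpN_l opprK E21 E12 v2E w2E e2_central e2E !formE !simp0.
case=> E1 E2.
(* Once g21 = - g12 is known, the e1-component [E3] says that g22 + lam g12 equals its own
   opposite. *)
have := FT111 _ _ _ h2 h2 h2.
rewrite e2_sqr E22 perpZ_l perpZ_r v2E w2E e2_central e2E !formE !simp0.
case=> E3 _.
have scaleI (x y : A) : lam *: x = lam *: y -> x = y.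
  by move/eqP; rewrite -subr_eq0 -scalerBr scaler_eq0 (negPf lam_neq0) subr_eq0 => /eqP.
have opp_id0 (x : A) : x = - x -> x = 0.
  move/eqP; rewrite -addr_eq0 -mulr2n -scaler_nat scaler_eq0 (negPf two_neq0).
  by move/eqP.
have g21E : g21 = - g12.
  by apply: scaleI; rewrite scalerN; apply: (@addIr _ (- g22)).
have g11E : g11 = 0.
  apply: scaleI; rewrite scaler0; apply: opp_id0.
  apply: (@addIr _ (g12 + g21)); rewrite addrA E2.
  by rewrite addrAC [RHS]addrC [g21 + _]addrC.
have g22E : g22 = - (lam *: g12).
  apply/subr0_eq/opp_id0; rewrite opprK.
  move: E3; rewrite !scaleNr opprK -[RHS]scalerN => /scaleI.
  by rewrite g21E scalerN -!opprD opprK addrC => ->.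
(* Centrality of e1 and e2 makes g12 central in A, hence a scalar: this is the parameter [b]. *)
have g12C a : g12 * a = a * g12.
  suff: form0 g12 * form0 a = form0 a * form0 g12 by rewrite -!form0M => -[].
  by rewrite -E12; apply: perp_central => {}a; rewrite ?e1_central ?e2_central.
have [b g12E] := bicross_center charF lam_neq0 g12C.
(* As Vol e1 = 0, the relation for (Vol, e1, e2) reads (Vol _|_ e1) e2 = Vol _|_ Vol - g12 Vol, and
   its left side is g12 Vol. *)
have gVE : gV = g12 + g12.
  have Ve1 : Vol * e1 = 0 by rewrite VolE e1E form_mulE !simp0.
  have := FT _ _ _ _ _ _ hV h1 h2; rewrite -[e1 * e2]/Vol EV E12 v1E Ve1 perp0_l.
  rewrite mulr0 add0r addn1 !exprS expr0 mulr1 !mulN1r opprK mulN1r VolE e2E.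
  rewrite form_mulE !formE !simp0 g21E g11E scaler0 subr0 opprK.
  by case=> E; rewrite {1}E subrK.
exists b; split;
  rewrite ?v1E ?v2E ?w1E ?w2E ?E11 ?E12 ?E21 ?E22 ?EV ?e1E ?e2E ?VolE
    ?gVE ?g21E ?g22E ?g11E ?g12E.
- by rewrite !formE !simp0 opprK.
- by rewrite !formE !simp0 opprK addNr.
- by rewrite !formE !simp0 opprK.
- by rewrite !formE !simp0 scalerN opprK addNr oppr0 opprK.
- by [].
- by rewrite form0Z.
- by rewrite -scaleNr form0Z scaleNr.
- by rewrite scalerA -scaleNr -mulNr form0Z.
- by rewrite !formE !simp0 -scalerDl mulr_natl mulr2n.
Qed.

End Solution.

(** * The explicit solution for each b, and its uniqueness *)

(** The extension of the values in [four_term_form] by A-linearity on both sides; on 1-forms it is b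
    times the Vol-coefficient of the product. *)
Definition std_perp (b : F) (x y : Om) : Om :=
  let: Form _ a1 a2 a3 := x in let: Form _ b1 b2 b3 := y in
  Form (b *: (a1 * b2 - a2 * b1 - lam *: (a2 * b2)))
    (b *: (a3 * b1 - a1 * b3)) (b *: (a3 * b2 - a2 * b3)) ((2 * b) *: (a3 * b3)).

Lemma std_perpE b a0 a1 a2 a3 b0 b1 b2 b3 :
  std_perp b (Form a0 a1 a2 a3) (Form b0 b1 b2 b3) =
  Form (b *: (a1 * b2 - a2 * b1 - lam *: (a2 * b2)))
    (b *: (a3 * b1 - a1 * b3)) (b *: (a3 * b2 - a2 * b3)) ((2 * b) *: (a3 * b3)).
Proof. by []. Qed.

(** The basis is central, so the coefficients of [x] can be pulled out on the left and those of [y]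
    on the right, leaving only the tabulated values. *)
Lemma four_term_form_std (perp : Om -> Om -> Om) b :
  four_term_solution perp -> four_term_form b perp ->
  forall x y, perp x y = std_perp b x y.
Proof.
move=> sol [Ve1 Ve2 /eqP e1V /eqP e2V e11 e12 e21 e22 VV].
case=> a0 a1 a2 a3 [b0 b1 b2 b3].
move: e1V e2V; rewrite !eqr_oppLR => /eqP e1V /eqP e2V.
have VC a : Vol * form0 a = form0 a * Vol.
  by rewrite -mulrA e2_central mulrA e1_central mulrA.
rewrite !form_basisE !(perpD_l sol, perpD_r sol, perp_form0l sol, perp_form0r sol).
rewrite !(perp_mull sol) -!e1_central -!e2_central -!VC !(perp_mulr sol).
rewrite !add0r Ve1 Ve2 e1V e2V e11 e12 e21 e22 VV e1E e2E VolE.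
rewrite -!form0_alg !formE /form0 ?formE !simp0 std_perpE.
congr Form; rewrite !(mulrA, mulr_algl, mulr_algr, mulNr, mulrN, mulrDl) -?scalerAl.
- by rewrite !scalerDr !scalerN scalerA scaleNr (mulrC lam) addrA.
- by rewrite scalerDr scalerN addrC.
- by rewrite scalerDr scalerN addrC.
- by [].
Qed.

Lemma std_perp_form b : four_term_form b (std_perp b).
Proof.
split; rewrite ?e1E ?e2E ?VolE /std_perp -?form0_alg ?formE ?simp0;
  rewrite ?scalerN ?opprK //.
by rewrite scalerA mulrC mulNr scaleNr.
Qed.

(** In every term the coefficients occur in the order of the arguments, so associativity and
    distributivity suffice although A is noncommutative. The 4-term relation is checked degree by
    degree. *)
Lemma std_perp_solution b : four_term_solution (std_perp b).
Proof.
have linl c (u v w : A) : (c *: u + v) * w = c *: (u * w) + v * w.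
  by rewrite mulrDl scalerAl.
have linr c (u v w : A) : w * (c *: u + v) = c *: (w * u) + w * v.
  by rewrite mulrDr scalerAr.
have twob (u : A) : (2 * b) *: u = b *: u + b *: u.
  by rewrite mulr_natl mulr2n scalerDl.
have scaleC (c d : F) (u : A) : c *: (d *: u) = d *: (c *: u).
  by rewrite !scalerA mulrC.
have lin c d (u v u' v' : A) :
    d *: ((c *: u + u') - (c *: v + v')) = c *: (d *: (u - v)) + d *: (u' - v').
  by rewrite scaleC -scalerDr (scalerBr c) opprD addrACA.
have lin1 c d (u u' : A) : d *: (c *: u + u') = c *: (d *: u) + d *: u'.
  by rewrite scaleC -scalerDr.
have lin3 c d (u v w u' v' w' : A) :
    d *: ((c *: u + u') - (c *: v + v') - lam *: (c *: w + w')) =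
    c *: (d *: (u - v - lam *: w)) + d *: (u' - v' - lam *: w').
  rewrite -lin; congr (_ *: (_ - _)); last by rewrite lin1.
  by rewrite scalerBr opprD addrACA.
have perp0l a y : std_perp b (form0 a) y = 0.
  by case: y => *; rewrite std_perpE !simp0.
have perp0r a x : std_perp b x (form0 a) = 0.
  by case: x => *; rewrite std_perpE !simp0.
have std_perp0l y : std_perp b 0 y = 0 by apply: perp0l 0 y.
have std_perp0r x : std_perp b x 0 = 0 by apply: perp0r 0 x.
have mull a x y : std_perp b (form0 a * x) y = form0 a * std_perp b x y.
  case: x y => [? a1 a2 a3] [? b1 b2 b3]; rewrite !formE !std_perpE ?formE.
  by rewrite -!scalerAr !mulrBr -scalerAr !mulrA.
have mulr a x y : std_perp b x (y * form0 a) = std_perp b x y * form0 a.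
  case: x y => [? a1 a2 a3] [? b1 b2 b3]; rewrite !formE !std_perpE ?formE.
  by rewrite -!scalerAl !mulrBl -scalerAl !mulrA.
have bal a x y : std_perp b (x * form0 a) y = std_perp b x (form0 a * y).
  by case: x y => [? a1 a2 a3] [? b1 b2 b3]; rewrite !formE !std_perpE !mulrA.
split=> //.
- case=> [? b1 b2 b3] c [? a1 a2 a3] [? a1' a2' a3'].
  rewrite !formE !std_perpE ?formE !linl; congr Form; [exact: lin3 | exact: lin..| exact: lin1].
- case=> [? b1 b2 b3] c [? a1 a2 a3] [? a1' a2' a3'].
  rewrite !formE !std_perpE ?formE !linr; congr Form; [exact: lin3 | exact: lin..| exact: lin1].
- move=> m n x y.
  case/homog_cases=> [[-> [a ->]]|[-> [a1 [a2 ->]]]|[-> [a3 ->]]|->];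
    case/homog_cases=> [[-> [a' ->]]|[-> [b1 [b2 ->]]]|[-> [b3 ->]]|->];
    rewrite ?perp0l ?perp0r ?std_perp0l ?std_perp0r; try by case: (_ < 2)%N => //; apply: homog0.
  - by rewrite std_perpE !simp0; eexists.
  - by rewrite std_perpE !simp0; apply/homog1E; eexists; eexists.
  - by rewrite std_perpE !simp0; apply/homog1E; eexists; eexists.
  - by rewrite std_perpE !simp0; apply/homog2E; eexists.
- move=> m n p x y z.
  case/homog_cases=> [[-> [a ->]]|[-> [a1 [a2 ->]]]|[-> [a3 ->]]|->].
  1: by rewrite mull !perp0l mul0r addr0 add0r.
  3: by rewrite !(mul0r, std_perp0l) !simp0.
  all: case/homog_cases=> [[-> [a' ->]]|[-> [b1 [b2 ->]]]|[-> [b3 ->]]|->].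
  1,5: by rewrite bal perp0l perp0r !simp0.
  3,6: by rewrite !(mul0r, mulr0, std_perp0l, std_perp0r) !simp0.
  all: case/homog_cases=> [[_ [a' ->]]|[_ [c1 [c2 ->]]]|[_ [c3 ->]]|->].
  1,5,9,13: by rewrite mulr !perp0r !simp0.
  3,6,9,12: by rewrite !(mul0r, mulr0, std_perp0l, std_perp0r) !simp0.
  all: rewrite ?addn1 ?addn2 ?exprS ?expr0 ?mulr1 ?(mulN1r, mulrN, mulNr, opprK).
  all: rewrite ?form_mulE ?std_perpE ?simp0.
  all: try by [].
  (* In degrees (1,1,1) each side vanishes by itself. The cases after it are (1,1,2), (1,2,1) and
     (2,1,1); the factor 2 in Vol _|_ Vol is what balances (1,1,2) and (2,1,1). *)
  + by rewrite !formE !simp0 !scalerN -!scalerAl -!scalerAr !addNr.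
  + rewrite !formE !simp0 twob opprD -!scalerAl subrK; congr Form.
    rewrite !(scalerN, mulrN) !(mulrBl, scalerBr) -?scalerAl -!scalerAr !mulrA.
    by rewrite (scaleC lam) !opprD !opprK.
  + rewrite !formE !simp0; congr Form.
    rewrite !(scalerN, mulNr) -!scalerAl -!scalerAr !mulrA.
    by rewrite (scaleC lam) !opprD !opprK.
  + rewrite !formE !simp0 twob -scalerAr addrK; congr Form.
    by rewrite !(mulrBr, scalerBr) -!scalerAl -!scalerAr !mulrA (scaleC lam).
Qed.

End FourTerm.

Theorem lemma4p1 (R : realType) (lambda : R[i])
    (lambda_imaginary : complex.Re lambda = 0) (lambda_neq0 : lambda != 0) :
  (forall perp : forms lambda -> forms lambda -> forms lambda,
     four_term_solution perp -> exists b : R[i], four_term_form b perp) /\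
  (forall b : R[i],
     exists! perp : forms lambda -> forms lambda -> forms lambda,
       four_term_solution perp /\ four_term_form b perp).
Proof.
split=> [perp sol|b].
  exact: four_term_solution_form sol (@pchar_num R[i]) lambda_neq0.
exists (std_perp b); split=> [|perp [sol form]].
  by split; [apply: std_perp_solution | apply: std_perp_form].
by do 2![apply/funext=> ?]; rewrite (four_term_form_std sol form).
Qed.
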